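(* Consider an ordered collection $\{\mathcal{Z}_j\}_{j=1}^p$ of subsets of $\mathbb{R}^{n_z}$ with $\mathcal{Z}_j=\{z: g_j(z)\leq 0\}$, where $g_j:\mathbb{R}^{n_z}\to\mathbb{R}^{m_j}$, and let violations of $\mathcal{Z}_j$ be quantified by $\mathcal{V}_{\mathcal{Z}_j}(z)=\|\max(0,\Lambda_j g_j(z))\|_2^2$ with $\Lambda_j\in\mathbb{R}^{m_j\times m_j}$ diagonal and positive definite. For $i=2,\dots,p$, let $z_i^*$ and $\epsilon_i^*$ be defined by the hierarchy of optimization problems $$\begin{aligned}(z_i^*,\epsilon_i^* )\in\operatorname{arg\,min}_{z\in\mathcal{Z}_1,\ \epsilon_i\in\mathbb{R}^{m_i}}\ &\|\Lambda_i\epsilon_i\|_2^2\\ \text{subject to }\ & g_j(z)\leq\epsilon_j^*,\quad j=2,\dots,i-1,\\ & g_i(z)\leq\epsilon_i.\end{aligned}$$ Then the iterated prioritized intersection satisfies $$\mathop{\sqcap}_{i=1}^{p}\mathcal{Z}_i=\mathcal{Z}_1\cap\{z: g_i(z)\leq\epsilon_i^*,\ i=2,\dots,p\}.$$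
   Context: Vector inequalities and the max function are applied elementwise. Prioritized intersection: for $\mathcal{Y},\mathcal{Z}\subseteq\mathbb{R}^{n_z}$ and a function $\mathcal{V}_{\mathcal{Z}}:\mathbb{R}^{n_z}\to\mathbb{R}$ that is positive outside $\mathcal{Z}$ and zero on $\mathcal{Z}$ (a violation function for $\mathcal{Z}$), the prioritized intersection is the set of minimizers $$\mathcal{Y}\sqcap\mathcal{Z}\triangleq\operatorname{arg\,min}_{z\in\mathcal{Y}}\mathcal{V}_{\mathcal{Z}}(z).$$ Iterated prioritized intersection of an ordered collection: $$\mathop{\sqcap}_{i=1}^{1}\mathcal{Z}_i=\mathcal{Z}_1,\qquad \mathop{\sqcap}_{i=1}^{p}\mathcal{Z}_i\triangleq\Big(\mathop{\sqcap}_{i=1}^{p-1}\mathcal{Z}_i\Big)\sqcap\mathcal{Z}_p.$$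
   Formalization: The formal theorem additionally assumes that, for each i = 2,…,p, the optimal ε_i* of the i-th problem is unique (every optimal pair has the same ε_i); without this the claim fails when two minimizers have different ε_i of equal weighted norm. *)

(* Defs.v *)
From mathcomp Require Import all_boot all_order all_algebra.
From mathcomp Require Import boolp classical_sets reals.

Set Implicit Arguments.
Unset Strict Implicit.
Unset Printing Implicit Defensive.

Import Order.TTheory GRing.Theory Num.Theory.

Local Open Scope classical_set_scope.
Local Open Scope ring_scope.

Definition argmin (R : realType) (T : Type) (D : set T) (f : T -> R) : set T :=
  [set x | D x /\ forall y, D y -> f x <= f y].

Definition is_violation (R : realType) (T : Type) (Z : set T) (V : T -> R) :=
  (forall z, Z z -> V z = 0) /\ (forall z, ~ Z z -> 0 < V z).

(* Y sqcap Z: it depends on Z only through the violation function V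
   chosen for Z, so V is the argument. *)
Definition prio_inter (R : realType) (T : Type) (Y : set T) (V : T -> R) :
    set T :=
  argmin Y V.

(* Families are indexed from 1, so index 0 of Z and V and index 1 of V are
   never used. At p = 0, where the iteration is not defined, the value is
   arbitrarily setT. *)
Fixpoint iter_prio_inter (R : realType) (T : Type) (Z : nat -> set T)
    (V : nat -> T -> R) (p : nat) : set T :=
  match p with
  | 0 => setT
  | 1 => Z 1%N
  | q.+1 => prio_inter (iter_prio_inter Z V q) (V q.+1)
  end.

Definition vec_le (R : realType) (m : nat) (u v : 'cV[R]_m) : Prop :=
  forall k, u k 0 <= v k 0.

Definition vec_max (R : realType) (m : nat) (u v : 'cV[R]_m) : 'cV[R]_m :=
  \col_k Num.max (u k 0) (v k 0).

(* The library norm on matrices is the sup norm, hence this definition. *)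
Definition norm2 (R : realType) (m : nat) (u : 'cV[R]_m) : R :=
  Num.sqrt (\sum_k u k 0 ^+ 2).

Definition posdef (R : realType) (m : nat) (A : 'M[R]_m) : Prop :=
  A^T = A /\ forall x : 'cV[R]_m, x != 0 -> 0 < (x^T *m A *m x) 0 0.

Definition sublevel (R : realType) (n m : nat) (g : 'cV[R]_n -> 'cV[R]_m) :
    set 'cV[R]_n :=
  [set z | vec_le (g z) 0].

Definition viol (R : realType) (n m : nat) (L : 'M[R]_m)
    (g : 'cV[R]_n -> 'cV[R]_m) (z : 'cV[R]_n) : R :=
  norm2 (vec_max 0 (L *m g z)) ^+ 2.

Definition hier_feasible (R : realType) (n : nat) (m : nat -> nat)
    (g : forall j, 'cV[R]_n -> 'cV[R]_(m j)) (eps : forall j, 'cV[R]_(m j))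
    (i : nat) : set ('cV[R]_n * 'cV[R]_(m i)) :=
  [set w | [/\ sublevel (g 1%N) w.1,
     forall j, (2 <= j < i)%N -> vec_le (g j w.1) (eps j) &
     vec_le (g i w.1) w.2]].
Arguments hier_feasible {R n m} g eps i _.

Definition hier_argmin (R : realType) (n : nat) (m : nat -> nat)
    (g : forall j, 'cV[R]_n -> 'cV[R]_(m j)) (L : forall j, 'M[R]_(m j))
    (eps : forall j, 'cV[R]_(m j)) (i : nat) : set ('cV[R]_n * 'cV[R]_(m i)) :=
  argmin (hier_feasible g eps i) (fun w => norm2 (L i *m w.2) ^+ 2).
Arguments hier_argmin {R n m} g L eps i _.

Lemma sqr_norm2 (R : realType) (m : nat) (u : 'cV[R]_m) :
  norm2 u ^+ 2 = \sum_k u k 0 ^+ 2.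
Proof. by rewrite sqr_sqrtr // sumr_ge0 // => k _; exact: sqr_ge0. Qed.

Lemma diag_mulE (R : realType) (m : nat) (L : 'M[R]_m) (v : 'cV[R]_m) k :
  is_diag_mx L -> (L *m v) k 0 = L k k * v k 0.
Proof.
move=> /is_diag_mxP dL; rewrite mxE (bigD1 k) //= big1 ?addr0 // => j jk.
by rewrite dL ?mul0r // eq_sym.
Qed.

Lemma posdef_diag_gt0 (R : realType) (m : nat) (L : 'M[R]_m) k :
  posdef L -> 0 < L k k.
Proof.
move=> [_ /(_ (delta_mx k 0))].
have -> : ((delta_mx k 0 : 'cV[R]_m)^T *m L *m (delta_mx k 0 : 'cV[R]_m)) 0 0 = L k k.
  by rewrite trmx_delta -rowE -colE !mxE.
apply; apply/eqP => /matrixP /(_ k 0); rewrite !mxE !eqxx /=.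
by move/eqP; rewrite oner_eq0.
Qed.

Lemma viol_is_violation (R : realType) (n m : nat) (L : 'M[R]_m)
    (g : 'cV[R]_n -> 'cV[R]_m) :
  is_diag_mx L -> posdef L -> is_violation (sublevel g) (viol L g).
Proof.
move=> dL pL; have L0 k := posdef_diag_gt0 k pL.
have E z : viol L g z = \sum_k Num.max 0 (L k k * g z k 0) ^+ 2.
  by rewrite /viol sqr_norm2; apply: eq_bigr => k _; rewrite !mxE -diag_mulE // mxE.
split=> z gz; rewrite E.
  apply: big1 => k _; rewrite max_l ?expr0n // pmulr_rle0 //.
  by have := gz k; rewrite mxE.
rewrite lt0r sumr_ge0 ?andbT => [|k _]; last exact: sqr_ge0.
apply/negP => /eqP /psumr_eq0P H; apply: gz => k; rewrite mxE.
have /eqP := H (fun i _ => sqr_ge0 _) k isT.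
rewrite sqrf_eq0 => /eqP M0; rewrite -(pmulr_rle0 _ (L0 k)) -M0.
by rewrite le_max lexx orbT.
Qed.

(* Main.v *)
(** Fix a stage [i], let [S] be the set of [z] allowed by the earlier stages and
    [r z] the positive part of [g_i z]. Since [Lam_i] is diagonal with a positive
    diagonal, the violation of [z] is the objective at the feasible slack [r z],
    and it is at most the objective at any slack [e >= g_i z]. Hence a violation
    minimizer [z] on [S] makes [(z, r z)] optimal, so [r z = eps_i] by uniqueness
    and [g_i z <= eps_i]; conversely, if [g_i z <= eps_i] then the violation of
    [z] is at most the optimal objective value. *)
Require Import Defs.
From mathcomp Require Import all_boot all_order all_algebra.
From mathcomp Require Import boolp classical_sets reals.

Import Order.TTheory GRing.Theory Num.Theory.

Local Open Scope classical_set_scope.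
Local Open Scope ring_scope.

Lemma vec_le_max0 {R : realType} {m : nat} (u : 'cV[R]_m) : vec_le u (vec_max 0 u).
Proof. by move=> k; rewrite !mxE le_max lexx orbT. Qed.

Section ViolationSlack.
Context {R : realType} {n m : nat} (L : 'M[R]_m) (g : 'cV[R]_n -> 'cV[R]_m).
Hypotheses (L_diag : is_diag_mx L) (L_posdef : posdef L).

(** Scaling by a nonnegative diagonal entry commutes with the maximum against 0. *)
Lemma viol_pos_part z : viol L g z = norm2 (L *m vec_max 0 (g z)) ^+ 2.
Proof.
rewrite /viol !sqr_norm2; apply: eq_bigr => k _; congr (_ ^+ 2).
rewrite (diag_mulE _ _ L_diag) !mxE maxr_pMr ?mulr0; last first.
  exact: ltW (posdef_diag_gt0 k L_posdef).
by rewrite -(diag_mulE _ _ L_diag) mxE.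
Qed.

Lemma viol_le_slack z e : vec_le (g z) e -> viol L g z <= norm2 (L *m e) ^+ 2.
Proof.
move=> gz_e; rewrite viol_pos_part !sqr_norm2; apply: ler_sum => k _.
rewrite !(diag_mulE _ _ L_diag) !exprMn ler_wpM2l ?sqr_ge0 // !mxE.
(* A negative entry of [e] can occur only in the first case, where the left side is 0; in the
   second, squaring is monotone. *)
have [gz_le0|gz_gt0] := leP (g z k 0) 0; first by rewrite expr0n sqr_ge0.
by rewrite lerXn2r ?nnegrE ?(ltW gz_gt0) ?(le_trans (ltW gz_gt0) (gz_e k)).
Qed.

End ViolationSlack.

Lemma prio_inter_hier {R : realType} {n : nat} {m : nat -> nat}
    (g : forall j : nat, 'cV[R]_n -> 'cV[R]_(m j))
    (L : forall j : nat, 'M[R]_(m j)) (eps : forall j : nat, 'cV[R]_(m j))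
    (i : nat) (x : 'cV[R]_n) :
  is_diag_mx (L i) -> posdef (L i) ->
  hier_argmin g L eps i (x, eps i) ->
  (forall z e, hier_argmin g L eps i (z, e) -> e = eps i) ->
  prio_inter (sublevel (g 1%N) `&`
      [set z | forall j, (2 <= j < i)%N -> vec_le (g j z) (eps j)])
    (viol (L i) (g i))
  = sublevel (g 1%N) `&`
      [set z | forall j, (2 <= j < i)%N -> vec_le (g j z) (eps j)] `&`
      [set z | vec_le (g i z) (eps i)].
Proof.
move=> Ld Lp [[x1 xj xi] opt] uniq; apply/seteqP; split=> z /=.
  move=> [[z1 zj] zmin]; split; first by split.
  suff <- : vec_max 0 (g i z) = eps i by exact: vec_le_max0.
  apply: (uniq z); split; first by split=> //; exact: vec_le_max0.
  move=> w w_feas /=; rewrite -viol_pos_part //.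
  (* The comparison passes through the given optimal point [x], whose violation is at most the
     objective at [eps i]. *)
  apply: le_trans (opt _ w_feas); apply: le_trans (zmin x (conj x1 xj)) _.
  exact: viol_le_slack.
move=> [[z1 zj] zi]; split=> [|y [y1 yj]]; first by split.
apply: le_trans (viol_le_slack _ _ Ld Lp _ _ zi) _.
rewrite [leRHS]viol_pos_part //.
by apply: (opt (y, vec_max 0 (g i y))); split=> //; exact: vec_le_max0.
Qed.

(** Without [eps_unique], two points with equal violation could have different optimal slacks, and
    the bound by one slack could exclude the other point. *)
Theorem lemma3 (R : realType) (n p : nat) (m : nat -> nat)
    (g : forall j : nat, 'cV[R]_n -> 'cV[R]_(m j))
    (Lam : forall j : nat, 'M[R]_(m j))
    (zs : nat -> 'cV[R]_n) (eps : forall j : nat, 'cV[R]_(m j))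
    (p_ge1 : (1 <= p)%N)
    (Lam_diag : forall j, (1 <= j <= p)%N -> is_diag_mx (Lam j))
    (Lam_posdef : forall j, (1 <= j <= p)%N -> posdef (Lam j))
    (zs_eps_opt : forall i, (2 <= i <= p)%N ->
       hier_argmin g Lam eps i (zs i, eps i))
    (eps_unique : forall i, (2 <= i <= p)%N ->
       forall x e, hier_argmin g Lam eps i (x, e) -> e = eps i) :
  iter_prio_inter (fun j => sublevel (g j)) (fun j => viol (Lam j) (g j)) p
  = sublevel (g 1%N) `&`
    [set z | forall i, (2 <= i <= p)%N -> vec_le (g i z) (eps i)].
Proof.
case: p p_ge1 Lam_diag Lam_posdef zs_eps_opt eps_unique => // p _.
elim: p => [|p IHp] Ld Lp opt uniq.
  apply/seteqP; split=> [z z1|z []] //; split=> // i.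
  by case/andP=> /leq_trans le2i /le2i.
have widen a j : (a <= j <= p.+1)%N -> (a <= j <= p.+2)%N.
  by move=> /andP[-> /leqW].
rewrite [LHS]/= -/(iter_prio_inter _ _ p.+1) IHp; first last.
- by move=> j /widen; exact: uniq.
- by move=> j /widen; exact: opt.
- by move=> j /widen; exact: Lp.
- by move=> j /widen; exact: Ld.
have i1 : (1 <= p.+2 <= p.+2)%N by rewrite leqnn.
have i2 : (2 <= p.+2 <= p.+2)%N by rewrite leqnn.
(* The range [j <= p.+1] left by the induction hypothesis is, by computation, the range [j < p.+2]
   of stage [p.+2]. *)
rewrite (prio_inter_hier _ _ _ _ _ (Ld _ i1) (Lp _ i1) (opt _ i2) (uniq _ i2)).
apply/seteqP; split=> z /=.
  move=> [[z1 zj] zi]; split=> // j; rewrite [(j <= _)%N]leq_eqVlt.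
  by case: eqP => [->|_ /zj].
by move=> [z1 zj]; split; [split=> // j /widen|]; exact: zj.
Qed.
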